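(* A function $\phi\colon \mathbb{R}\to\mathbb{R}$ is a strongly maximal general dual-feasible function (gDFF) if and only if $\phi$ is a restricted maximal gDFF and $\lim_{\epsilon\to 0^+}\frac{\phi(\epsilon)}{\epsilon}=0$.
   Context: A function $\phi\colon\mathbb{R}\to\mathbb{R}$ is a (valid) general dual-feasible function (gDFF) if for every finite family $(x_i)_{i\in I}$ of real numbers (repetitions allowed), $\sum_{i\in I}x_i\le 1$ implies $\sum_{i\in I}\phi(x_i)\le 1$. A gDFF $\phi$ is implied via scaling by a gDFF $\phi_1$ if $\beta\phi_1\ge\phi$ pointwise for some $0\le\beta\le 1$; $\phi$ is restricted maximal if it is not implied via scaling by any gDFF $\phi_1\neq\phi$. A gDFF $\phi$ is implied by a gDFF $\phi_1$ if there are $0\le\alpha,\beta\le 1$ with $\alpha+\beta\le 1$ such that $\phi(x)\le\beta\phi_1(x)+\alpha x$ for all $x\in\mathbb{R}$; $\phi$ is strongly maximal if it is not implied by any gDFF $\phi_1\ne\phi$. *)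

(* Defs.v *)
From HB Require Import structures.
From mathcomp Require Import all_boot all_order all_algebra.
From mathcomp Require Import all_classical all_reals all_analysis.

Set Implicit Arguments.
Unset Strict Implicit.
Unset Printing Implicit Defensive.

Import Order.TTheory GRing.Theory Num.Theory.
Import numFieldNormedType.Exports.

Local Open Scope ring_scope.

(* Families are indexed by an arbitrary finite type, so repeated values and
   the empty family are allowed. *)
Definition gDFF (R : realType) (phi : R -> R) : Prop :=
  forall (I : finType) (x : I -> R),
    \sum_(i : I) x i <= 1 -> \sum_(i : I) phi (x i) <= 1.

Definition implied_via_scaling (R : realType) (phi phi1 : R -> R) : Prop :=
  exists beta : R, 0 <= beta <= 1 /\ (forall x : R, phi x <= beta * phi1 x).

Definition restricted_maximal (R : realType) (phi : R -> R) : Prop :=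
  gDFF phi /\
  (forall phi1 : R -> R,
     gDFF phi1 -> phi1 <> phi -> ~ implied_via_scaling phi phi1).

Definition implied (R : realType) (phi phi1 : R -> R) : Prop :=
  exists alpha beta : R,
    [/\ 0 <= alpha <= 1, 0 <= beta <= 1, alpha + beta <= 1
      & forall x : R, phi x <= beta * phi1 x + alpha * x].

Definition strongly_maximal (R : realType) (phi : R -> R) : Prop :=
  gDFF phi /\
  (forall phi1 : R -> R,
     gDFF phi1 -> phi1 <> phi -> ~ implied phi phi1).

(* Main.v *)
Require Import Defs.
From HB Require Import structures.
From mathcomp Require Import all_boot all_order all_algebra.
From mathcomp Require Import all_classical all_reals all_analysis.
From mathcomp Require Import lra.

(** Call a gDFF maximal when no other gDFF dominates it pointwise.  The proof
    rests on two observations.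

    The first is that a maximal gDFF absorbs decompositions
    ([maximal_sum_le]): if finitely many reals add up to at most [x], the sum
    of their values is at most [phi x], since otherwise raising [phi] at the
    single point [x] to that sum would give a larger gDFF.  Hence a maximal
    [phi] is nonnegative on the nonnegative reals, and [n * phi eps <= phi x]
    whenever [n * eps <= x].  The latter makes the slope [phi x / x] at any
    [x > 0] an asymptotic upper bound for the slopes [phi eps / eps] at [0+].

    The second is that linear functions can be mixed into a gDFF and split off
    again: [beta * phi1 + alpha * x] is a gDFF if [phi1] is and
    [alpha + beta <= 1] ([gDFF_mix]), and conversely a gDFF lying above
    [c * t] for all [t >= 0], with [0 <= c < 1], is the mixture of [c * x] with
    another gDFF ([gDFF_unmix]).

    If [phi] is strongly maximal, then no [c * x] with [0 < c < 1] can be split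
    off, so [phi x / x] takes values below every such [c] on the positive
    reals, and the first observation sends [phi eps / eps] to [0].

    If [phi] is restricted maximal and implied by [phi1], it equals the mixture
    [beta * phi1 + alpha * x] that dominates it.  When [beta > 0], [phi1] is then
    itself maximal, hence nonnegative on the nonnegative reals; in every case
    [phi eps / eps >= alpha], so the limit [0] forces [alpha = 0] and the
    implication is one via scaling. *)

Set Implicit Arguments.
Unset Strict Implicit.
Unset Printing Implicit Defensive.

Import Order.TTheory GRing.Theory Num.Theory.
Import numFieldNormedType.Exports.

Local Open Scope classical_set_scope.
Local Open Scope ring_scope.

(** Sequences are easier to cut and concatenate than families over finite
    types. *)
Lemma gDFF_seqP (R : realType) (phi : R -> R) :
  gDFF phi <->
  (forall s : seq R, \sum_(x <- s) x <= 1 -> \sum_(x <- s) phi x <= 1).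
Proof.
split=> [phiP s|phiP I x].
  by rewrite !(big_tnth _ _ s); exact: (phiP _ (tnth (in_tuple s))).
move=> le1; have := phiP [seq x i | i <- index_enum I].
by rewrite !big_map; exact.
Qed.

Lemma gDFF_mix (R : realType) (phi : R -> R) (alpha beta : R) :
  0 <= alpha -> 0 <= beta -> alpha + beta <= 1 -> gDFF phi ->
  gDFF (fun x => beta * phi x + alpha * x).
Proof.
move=> a0 b0 ab1 phiP I x le1.
rewrite big_split /= -!mulr_sumr (le_trans _ ab1)// addrC.
by rewrite lerD// ler_piMr// phiP.
Qed.

(** Completing a family of sum [1 - t] by the extra element [t] turns the bound
    [1] on its values into [1 - phi t <= 1 - c * t], which is exactly what
    remains after subtracting [c * x] from [phi] and rescaling. *)
Lemma gDFF_unmix (R : realType) (phi : R -> R) (c : R) :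
  c < 1 -> gDFF phi -> (forall t, 0 <= t -> c * t <= phi t) ->
  gDFF (fun x => (1 - c)^-1 * (phi x - c * x)).
Proof.
move=> c1 /gDFF_seqP phiP phi_ge; apply/gDFF_seqP => s le1.
rewrite -mulr_sumr sumrB -mulr_sumr ler_pdivrMl ?subr_gt0// mulr1.
set S := \sum_(x <- s) x in le1 *.
have := phiP (1 - S :: s); rewrite !big_cons -/S subrK => /(_ (lexx _)).
have := phi_ge (1 - S); rewrite subr_ge0 => /(_ le1).
lra.
Qed.

Definition maximal_gDFF (R : realType) (phi : R -> R) : Prop :=
  gDFF phi /\
  (forall phi1 : R -> R, gDFF phi1 -> (forall x, phi x <= phi1 x) -> phi1 = phi).

Lemma restricted_maximal_maximal (R : realType) (phi : R -> R) :
  restricted_maximal phi -> maximal_gDFF phi.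
Proof.
move=> [phiP phi_max]; split=> // phi1 phi1P le1.
apply: contrapT => neq; apply: (phi_max _ phi1P neq).
by exists 1; split=> [|x]; rewrite ?ler01 ?lexx// mul1r.
Qed.

Lemma strongly_maximal_restricted (R : realType) (phi : R -> R) :
  strongly_maximal phi -> restricted_maximal phi.
Proof.
move=> [phiP phi_max]; split=> // phi1 phi1P neq [beta [beta01 le1]].
apply: (phi_max _ phi1P neq); exists 0, beta.
split=> [||/[!add0r]|x]; rewrite ?lexx ?ler01//; first by case/andP: beta01.
by rewrite mul0r addr0.
Qed.

(** Raise [phi] at the single point [x] to the larger of its value and the sum
    over [t]: in any family, each occurrence of [x] may be replaced by [t]
    without increasing the total, so the new function is still a gDFF. *)
Lemma maximal_sum_le (R : realType) (phi : R -> R) (t : seq R) (x : R) :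
  maximal_gDFF phi -> \sum_(y <- t) y <= x -> \sum_(y <- t) phi y <= phi x.
Proof.
move=> [/gDFF_seqP phiP phi_max] tx; rewrite leNgt; apply/negP => lt_phi.
pose phi1 y := if y == x then \sum_(z <- t) phi z else phi y.
have phi1P : gDFF phi1.
  apply/gDFF_seqP => s le1.
  have := phiP (flatten [seq if y == x then t else [:: y] | y <- s]).
  rewrite !big_flatten !big_map => le_flat.
  rewrite (le_trans _ (le_flat _)) //.
    by apply: ler_sum => y _; rewrite /phi1; case: eqP; rewrite ?big_seq1.
  apply: le_trans le1; apply: ler_sum => y _.
  by case: eqP => [->|_]; rewrite ?big_seq1.
have phi_le y : phi y <= phi1 y.
  by rewrite /phi1; case: eqP => [->|_]; rewrite ?(ltW lt_phi).
have /(congr1 (@^~ x)) := phi_max _ phi1P phi_le.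
by rewrite /phi1 eqxx => eq_phi; rewrite eq_phi ltxx in lt_phi.
Qed.

Lemma maximal_ge0 (R : realType) (phi : R -> R) (x : R) :
  maximal_gDFF phi -> 0 <= x -> 0 <= phi x.
Proof. by move=> /(@maximal_sum_le _ _ [::] x); rewrite !big_nil. Qed.

Lemma maximal_mulrn_le (R : realType) (phi : R -> R) (n : nat) (e x : R) :
  maximal_gDFF phi -> e *+ n <= x -> phi e *+ n <= phi x.
Proof.
move=> /(@maximal_sum_le _ _ (nseq n e) x).
by rewrite !big_nseq -!Monoid.iteropE.
Qed.

(** About [x / e] copies of [e] fit below [x], and the uncovered part has length
    at most [e <= x / 2]; this loses at most a factor 2 in the slope. *)
Lemma maximal_slope_lt (R : realType) (phi : R -> R) (c e x : R) :
  maximal_gDFF phi -> 0 < e -> e <= x / 2 -> phi x < c * x ->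
  phi e / e < 2 * c.
Proof.
move=> phiP e0 ex phix.
have x0 : 0 <= x by lra.
have xe0 : 0 <= x / e by rewrite divr_ge0// ltW.
have c0 : 0 < c.
  have := le_lt_trans (maximal_ge0 phiP x0) phix.
  by rewrite pmulr_lgt0//; lra.
have /andP[le_n lt_n] := truncn_itv xe0.
set n := Num.truncn (x / e) in le_n lt_n.
have nex : e *+ n <= x by rewrite -mulr_natl -ler_pdivlMr.
have := maximal_mulrn_le phiP nex.
move: lt_n; rewrite ltr_pdivrMr// -natr1 => lt_n phi_n.
rewrite ltNge; apply/negP; rewrite ler_pdivlMr// => ge_phi.
have : (2 * c * e) *+ n <= phi e *+ n by rewrite lerMn2r ge_phi orbT.
rewrite -(mulr_natl _ n) => ge_n.
have : 2 * c * (x / 2) <= 2 * c * (n%:R * e) by rewrite ler_pM2l; lra.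
lra.
Qed.

(** Otherwise [c * x] could be split off, and [phi] would be implied by the
    remaining gDFF; that one is equal to [phi] only when [phi] is the identity,
    which is implied by the zero function. *)
Lemma strongly_maximal_slope (R : realType) (phi : R -> R) (c : R) :
  strongly_maximal phi -> 0 < c < 1 -> exists2 x, 0 <= x & phi x < c * x.
Proof.
move=> [phiP phi_max] /andP[c0 c1]; apply: contrapT => no_x.
have phi_ge t : 0 <= t -> c * t <= phi t.
  by move=> t0; rewrite leNgt; apply/negP => lt_t; apply: no_x; exists t.
have c1N : 1 - c != 0 by rewrite gt_eqF// subr_gt0.
apply: (phi_max _ (gDFF_unmix c1 phiP phi_ge)).
  move=> /funeqP eq_phi.
  have phi_id x : phi x = x.
    have := congr1 ( *%R (1 - c)) (eq_phi x); rewrite /= mulrA divff// mul1r.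
    move=> eqx; apply: (mulfI (lt0r_neq0 c0)); lra.
  apply: (phi_max (fun=> 0)).
  - by move=> I x _; rewrite big1// ler01.
  - by move=> /funeqP /(_ 1) /esym/eqP; rewrite phi_id oner_eq0.
  - exists 1, 0; split=> [||/[!addr0]|x]; rewrite ?lexx ?ler01//.
    by rewrite phi_id mul0r add0r mul1r.
exists c, (1 - c); split; try lra.
by move=> x; rewrite mulrA divff// mul1r subrK.
Qed.

Lemma strongly_maximal_cvg0 (R : realType) (phi : R -> R) :
  strongly_maximal phi -> phi eps / eps @[eps --> 0^'+] --> (0 : R).
Proof.
move=> phi_sm.
have phi_max := restricted_maximal_maximal (strongly_maximal_restricted phi_sm).
apply/cvgrPdist_lt => e e0.
pose c := Num.min e 1 / 2.
have min0 : 0 < Num.min e 1 by rewrite lt_min e0 ltr01.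
have min1 : Num.min e 1 <= 1 by rewrite ge_min lexx orbT.
have [|x x0 phix] := strongly_maximal_slope (c := c) phi_sm.
  by rewrite /c; apply/andP; split; lra.
have xgt0 : 0 < x.
  rewrite lt_neqAle x0 andbT; apply/eqP => xE; move: phix.
  by rewrite -xE mulr0 ltNge (maximal_ge0 phi_max).
near=> eps.
have eps0 : 0 < eps by near: eps; exact: nbhs_right_gt.
have epsx : eps <= x / 2 by near: eps; apply: nbhs_right_le; rewrite divr_gt0.
rewrite sub0r normrN ger0_norm ?divr_ge0 ?(maximal_ge0 phi_max) ?ltW//.
have := maximal_slope_lt phi_max eps0 epsx phix.
move=> /lt_le_trans; apply.
by rewrite /c mulrC divfK// ge_min lexx.
Unshelve. all: by end_near. Qed.

(** Any gDFF above [phi1] would yield a mixture above the maximal one. *)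
Lemma maximal_mix_component (R : realType) (phi1 : R -> R) (alpha beta : R) :
  0 <= alpha -> 0 < beta -> alpha + beta <= 1 -> gDFF phi1 ->
  maximal_gDFF (fun x => beta * phi1 x + alpha * x) -> maximal_gDFF phi1.
Proof.
move=> a0 b0 ab1 phi1P [_ mix_max]; split=> // psi psiP le_psi.
have /funeqP eq_mix : (fun x => beta * psi x + alpha * x) =
    (fun x => beta * phi1 x + alpha * x).
  apply: mix_max; first exact: gDFF_mix (ltW b0) ab1 psiP.
  by move=> x; rewrite lerD2r ler_pM2l.
by apply/funext => x; apply/(mulfI (lt0r_neq0 b0))/(addIr _ (eq_mix x)).
Qed.

Lemma maximal_implied_slope (R : realType) (phi phi1 : R -> R)
    (alpha beta x : R) :
  maximal_gDFF phi -> gDFF phi1 -> 0 <= alpha -> 0 <= beta ->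
  alpha + beta <= 1 -> (forall y, phi y <= beta * phi1 y + alpha * y) ->
  0 <= x -> alpha * x <= phi x.
Proof.
move=> phi_max phi1P a0 b0 ab1 le_mix x0.
(* maximality turns the inequality [le_mix] into an equality *)
have mixE := phi_max.2 _ (gDFF_mix a0 b0 ab1 phi1P) le_mix.
rewrite -mixE lerDr; have [->|bN0] := eqVneq beta 0; first by rewrite mul0r.
have bgt0 : 0 < beta by rewrite lt_neqAle eq_sym bN0.
rewrite mulr_ge0// maximal_ge0//.
by apply: (maximal_mix_component a0 bgt0 ab1 phi1P); rewrite mixE.
Qed.

Theorem theorem5 (R : realType) (phi : R -> R) :
  strongly_maximal phi <->
  restricted_maximal phi /\ (phi eps / eps @[eps --> 0^'+] --> (0 : R)).
Proof.
split=> [phi_sm|[phi_rm phi_cvg]].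
  by split; [exact: strongly_maximal_restricted|exact: strongly_maximal_cvg0].
have phi_max := restricted_maximal_maximal phi_rm.
split=> [|phi1 phi1P neq]; first exact: phi_rm.1.
move=> [alpha [beta [/andP[a0 _] beta01 ab1 le_mix]]].
have b0 : 0 <= beta by case/andP: beta01.
have alpha_le0 : alpha <= 0.
  apply: (cvgr_to_ge phi_cvg); near=> eps.
  have eps0 : 0 < eps by near: eps; exact: nbhs_right_gt.
  rewrite ler_pdivlMr//.
  exact: maximal_implied_slope phi_max phi1P a0 b0 ab1 le_mix (ltW eps0).
have alpha0 : alpha = 0 by apply/le_anti; rewrite alpha_le0.
apply: (phi_rm.2 _ phi1P neq); exists beta; split=> // x.
by have := le_mix x; rewrite alpha0 mul0r addr0.
Unshelve. all: by end_near. Qed.
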